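(* Let $\alpha\ge0$ and $\alpha'>\alpha$. Assume that $F:\mathbb{R}^d\to\mathbb{R}^p$ is continuous, that there exists $C_\alpha\ge0$ with $\sup_{x\in\mathbb{R}^d}\|F(x)\|(1+\|x\|^\alpha)^{-1}\le C_\alpha<+\infty$, and that there exists $\eta>0$ with $\int_{\mathbb{R}^d}\exp[\eta\|x\|^{\alpha'}]\,\mathrm{d}\mu(x)<+\infty$. (a) If for every $\theta\in\mathbb{R}^p$ with $\|\theta\|=1$ we have $$\mu\big(\{x\in\mathbb{R}^d:\langle F(x),\theta\rangle<0\}\big)>0,\qquad( * )$$ then a solution $\theta^\star$ of (Q) exists and $\pi_{\theta^\star}$ is the solution of (P). (b) In particular, condition $( * )$ (for every $\theta$ with $\|\theta\|=1$) is satisfied if $\mu(A)>0$ for every non-empty open set $A\subset\mathbb{R}^d$, $F$ is continuous, and there exists $x\in F^{-1}(\{0\})$ such that $F$ is differentiable at $x$ and $\det(\mathrm{D}F(x)\mathrm{D}F(x)^{\top})>0$, where $\mathrm{D}F(x)$ is the Jacobian matrix of $F$ at $x$.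
   Context: $\mu$ is a probability measure on $(\mathbb{R}^d,\mathcal{B}(\mathbb{R}^d))$ (the reference measure), and there is a point $x_0\in\mathbb{R}^d$ with $F(x_0)=0$ (standing assumption). For a probability measure $\pi$, $\pi(F)=\int F\,\mathrm{d}\pi$. $\mathcal{P}_\alpha$ is the set of Borel probability measures $\pi$ on $\mathbb{R}^d$ with $\int\|x\|^\alpha\,\mathrm{d}\pi(x)<+\infty$, and $\mathcal{P}_\alpha^F=\{\pi\in\mathcal{P}_\alpha:\pi(F)=0\}$. $\mathrm{KL}(\pi|\mu)=\int \frac{\mathrm{d}\pi}{\mathrm{d}\mu}\log\frac{\mathrm{d}\pi}{\mathrm{d}\mu}\,\mathrm{d}\mu$ if $\pi\ll\mu$ and $+\infty$ otherwise. Problem (P): minimize $\mathrm{KL}(\pi|\mu)$ subject to $\pi\in\mathcal{P}_\alpha^F$. Let $\Theta_F=\{\theta\in\mathbb{R}^p:\int\exp[-\langle\theta,F(x)\rangle]\,\mathrm{d}\mu(x)<+\infty\}$. Problem (Q): maximize $\inf_{\pi\in\mathcal{P}_\alpha}\{\mathrm{KL}(\pi|\mu)+\langle\theta,\pi(F)\rangle\}$ subject to $\theta\in\Theta_F$. For $\theta\in\Theta_F$, $L(\theta)=\log\int\exp[-\langle\theta,F(x)\rangle]\,\mathrm{d}\mu(x)$ and $\pi_\theta$ is the probability measure with $\frac{\mathrm{d}\pi_\theta}{\mathrm{d}\mu}(x)=\exp[-\langle\theta,F(x)\rangle-L(\theta)]$. *)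

(* Defs.v *)
From HB Require Import structures.
From mathcomp Require Import all_boot all_order all_algebra.
From mathcomp Require Import all_classical all_reals all_analysis.

Set Implicit Arguments.
Unset Strict Implicit.
Unset Printing Implicit Defensive.

Import Order.TTheory GRing.Theory Num.Theory.
Import numFieldNormedType.Exports.

Local Open Scope classical_set_scope.
Local Open Scope ring_scope.
Local Open Scope charge_scope.

(* Vectors are row vectors 'rV[R]_n; this is R^n with its Borel sigma-algebra,
   a type convertible to 'rV[R]_n. *)
Notation borel_rV R n := (g_sigma_algebraType (@open 'rV[R]_n)).

Definition dotp (R : realType) (n : nat) (u v : 'rV[R]_n) : R :=
  \sum_(i < n) u 0 i * v 0 i.

(* The library norm `|u| on 'rV[R]_n is the sup norm, which induces the same
   topology and the same differentials but not the same unit sphere. *)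
Definition enorm (R : realType) (n : nat) (u : 'rV[R]_n) : R :=
  Num.sqrt (dotp u u).

(* The library derivative 'J f x acts on row vectors by right multiplication:
   its (i, j) entry is the i-th partial derivative of the j-th component. *)
Definition jacobian_mx (R : realType) (d p : nat)
    (F : 'rV[R]_d -> 'rV[R]_p) (x : 'rV[R]_d) : 'M[R]_(p, d) :=
  (jacobian F x)^T.

Section measures.
Context (R : realType) (d p : nat).
Implicit Types (mu nu : probability (borel_rV R d) R) (alpha : R).
Implicit Types (F : 'rV[R]_d -> 'rV[R]_p) (theta : 'rV[R]_p).

Definition density nu mu : borel_rV R d -> \bar R :=
  'd (charge_of_finite_measure nu) '/d mu.

(* The derivative is finite everywhere when nu `<< mu, so fine loses nothing;
   the integrand is 0 where the density vanishes. *)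
Definition KL nu mu : \bar R :=
  if `[< nu `<< mu >] then
    (\int[mu]_x (fine (density nu mu x) * ln (fine (density nu mu x)))%:E)%E
  else +oo%E.

(* nu(F), integrated componentwise. *)
Definition mean nu F : 'rV[R]_p := \row_(i < p) \int[nu]_x (F x 0 i).

(* powR satisfies 0 `^ 0 = 1, so alpha = 0 imposes no condition. *)
Definition moment_prob alpha : set (probability (borel_rV R d) R) :=
  [set nu : probability (borel_rV R d) R |
    (\int[nu]_x (enorm (x : 'rV[R]_d) `^ alpha)%:E < +oo)%E].

Definition feasible_prob alpha F : set (probability (borel_rV R d) R) :=
  [set nu | moment_prob alpha nu /\ mean nu F = 0].

Definition Theta mu F : set 'rV[R]_p :=
  [set theta | (\int[mu]_x (expR (- dotp theta (F x)))%:E < +oo)%E].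

Definition log_partition mu F theta : R :=
  ln (\int[mu]_x expR (- dotp theta (F x))).

Definition is_gibbs mu F theta nu : Prop :=
  nu `<< mu /\
  ae_eq mu setT (density nu mu)
    (fun x => (expR (- dotp theta (F x) - log_partition mu F theta))%:E).

Definition dual_value alpha mu F theta : \bar R :=
  ereal_inf [set (KL nu mu + (dotp theta (mean nu F))%:E)%E
            | nu in moment_prob alpha].

Definition solves_P alpha mu F nu : Prop :=
  feasible_prob alpha F nu /\
  forall nu', feasible_prob alpha F nu' -> (KL nu mu <= KL nu' mu)%E.

(* Library measures are functions on all sets, so a solution can be unique
   only as a function on measurable sets. *)
Definition is_the_solution_P alpha mu F nu : Prop :=
  solves_P alpha mu F nu /\
  forall nu', solves_P alpha mu F nu' ->
    forall A : set (borel_rV R d), measurable A -> nu' A = nu A.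

Definition solves_Q alpha mu F theta : Prop :=
  Theta mu F theta /\
  forall theta', Theta mu F theta' ->
    (dual_value alpha mu F theta' <= dual_value alpha mu F theta)%E.

Definition charges_negative_side mu F : Prop :=
  forall theta, enorm theta = 1 ->
    (0 < mu [set x : borel_rV R d | (dotp (F x) theta < 0)%R])%E.

End measures.

(* Main.v *)
(** Write Z(theta) for the integral of exp(-<theta, F>) with respect to mu.  It
    is finite and locally Lipschitz because exp(eta |x|^alpha') dominates every
    exp(c (1 + |x|^alpha)).  It dominates the integral of max(0, -<theta, F>),
    which is positively homogeneous and, by the sign condition, positive on the
    unit sphere; hence Z is coercive and attains its minimum at some theta0.
    First-order optimality of theta0 says that F has mean zero under the Gibbs
    measure pi0.  The variational principle
      KL(nu | mu) >= - <theta0, nu(F)> - log Z(theta0),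
    with equality only at nu = pi0, then gives at once that pi0 is the unique
    solution of (P), that theta0 has dual value - log Z(theta0), and that no
    theta does better, because pi0 itself is admissible in every dual infimum.

    For the second part, a right inverse of the Jacobian provides a direction v
    with DF(x) v = - theta, along which <F, theta> becomes negative. *)

Require Import Defs.
From HB Require Import structures.
From mathcomp Require Import all_boot all_order all_algebra.
From mathcomp Require Import all_classical all_reals all_analysis.
From mathcomp Require Import measurable_realfun.
From mathcomp Require Import ring lra.

Import Order.TTheory GRing.Theory Num.Theory.
Import numFieldNormedType.Exports.

Set Implicit Arguments.
Unset Strict Implicit.
Unset Printing Implicit Defensive.

Local Open Scope classical_set_scope.
Local Open Scope ring_scope.
(** * The scalar product, and part (b) *)

Section dot_product.
Context (R : realType) (n : nat).
Implicit Types u v w : 'rV[R]_n.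

Lemma dotp_additive u : {morph dotp u : v w / v + w}.
Proof.
by move=> v w; rewrite /dotp -big_split; apply: eq_bigr => i _; rewrite mxE mulrDr.
Qed.

Lemma dotpC u v : dotp u v = dotp v u.
Proof. by apply: eq_bigr => i _; rewrite mulrC. Qed.

Lemma dotpDl u v w : dotp (u + v) w = dotp u w + dotp v w.
Proof. by rewrite dotpC dotp_additive !(dotpC w). Qed.

Lemma dotpZl a u v : dotp (a *: u) v = a * dotp u v.
Proof. by rewrite mulr_sumr; apply: eq_bigr => i _; rewrite mxE mulrA. Qed.

Lemma dotpNl u v : dotp (- u) v = - dotp u v.
Proof. by rewrite -scaleN1r dotpZl mulN1r. Qed.

Lemma dotpBl u v w : dotp (u - v) w = dotp u w - dotp v w.
Proof. by rewrite dotpDl dotpNl. Qed.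

Lemma dotp0r u : dotp u 0 = 0.
Proof. by rewrite /dotp big1// => i _; rewrite mxE mulr0. Qed.

Lemma dotp_deltal i u : dotp (delta_mx 0 i) u = u 0 i.
Proof.
rewrite /dotp (bigD1 i)//= big1 ?addr0 => [|j /negPf ji]; last first.
  by rewrite mxE ji andbF mul0r.
by rewrite mxE !eqxx mul1r.
Qed.

Lemma dotp_ge0 u : 0 <= dotp u u.
Proof. by apply: sumr_ge0 => i _; exact: sqr_ge0. Qed.

Lemma dotp_gt0 u : u != 0 -> 0 < dotp u u.
Proof.
move=> u0; rewrite lt_neqAle dotp_ge0 andbT eq_sym; apply: contra u0.
rewrite psumr_eq0 => [/allP u0|i _]; last exact: sqr_ge0.
apply/eqP/rowP => i; rewrite mxE; apply/eqP.
by move: (u0 i (mem_index_enum i)); rewrite mulf_eq0 orbb.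
Qed.

Lemma enorm_ge0 u : 0 <= enorm u.
Proof. exact: sqrtr_ge0. Qed.

Lemma enormZ a u : enorm (a *: u) = `|a| * enorm u.
Proof.
by rewrite /enorm dotpZl dotpC dotpZl mulrA -expr2 sqrtrM ?sqr_ge0// sqrtr_sqr.
Qed.

Lemma enorm_gt0 u : u != 0 -> 0 < enorm u.
Proof. by move=> u0; rewrite sqrtr_gt0 dotp_gt0. Qed.

Lemma coord_le_enorm u i : `|u 0 i| <= enorm u.
Proof.
rewrite -sqrtr_sqr ler_wsqrtr// expr2 /dotp (bigD1 i)//= lerDl.
by apply: sumr_ge0 => j _; exact: sqr_ge0.
Qed.

Lemma coord_le_norm u i : `|u 0 i| <= `|u|.
Proof.
rewrite [leRHS]/Num.norm/= mx_normrE.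
by apply: le_trans (le_bigmax _ (fun k => `|u k.1 k.2|) (ord0, i)).
Qed.

(** The sup norm of [u] enters because continuity in the parameter is measured in it, while [v] is
    controlled through its coordinates, as [F x] will be by a weight. *)
Lemma normr_dotp_le u v (a : R) : (forall i, `|v 0 i| <= a) ->
  `|dotp u v| <= n%:R * `|u| * a.
Proof.
move=> va; apply: le_trans (ler_norm_sum _ _ _) _.
rewrite -mulrA mulr_natl -[X in _ *+ X]card_ord -sumr_const.
apply: ler_sum => i _; rewrite normrM.
by apply: ler_pM => //; exact: coord_le_norm.
Qed.

Lemma continuous_dotp (U : topologicalType) (f g : U -> 'rV[R]_n) :
  continuous f -> continuous g -> continuous (fun x => dotp (f x) (g x)).
Proof.
move=> cf cg; have ac : continuous (fun z : R * R => z.1 + z.2).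
  by move=> z; exact: add_continuous.
have coordc (h : U -> 'rV[R]_n) i : continuous h -> continuous (fun x => h x 0 i).
  move=> ch x; apply: (@continuous_comp _ _ _ h (fun v : 'rV[R]_n => v 0 i)).
    exact: ch.
  exact: (@coord_continuous _ 1 n 0 i (h x)).
have := @continuous_big _ _ +%R 0 xpredT ac U (index_enum 'I_n)
  (fun i x => f x 0 i * g x 0 i).
apply => i _ x.
by apply: (@continuousM _ _ (fun x => f x 0 i) (fun x => g x 0 i)); apply: coordc.
Qed.

Lemma continuous_dotpr u : continuous (dotp u).
Proof.
apply: (@continuous_dotp _ (cst u) id) => v; first exact: cst_continuous.
exact: cvg_id.
Qed.

End dot_product.

Lemma charges_negative_side_regular_zero (R : realType) (d p : nat)
    (mu : probability (borel_rV R d) R) (F : 'rV[R]_d -> 'rV[R]_p)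
    (x : 'rV[R]_d) :
  continuous F ->
  (forall A : set 'rV[R]_d, open A -> A !=set0 ->
      (0 < mu (A : set (borel_rV R d)))%E) ->
  F x = 0 -> differentiable F x ->
  jacobian_mx F x *m (jacobian_mx F x)^T \in unitmx ->
  charges_negative_side mu F.
Proof.
move=> Fc mu_gt0 Fx0 Fx; set Q := _ *m _ => Qu theta theta1.
have theta0 : theta != 0.
  apply/eqP => t0; move: theta1; rewrite t0 /enorm dotp0r sqrtr0 => /eqP.
  by rewrite eq_sym oner_eq0.
(* The Gram matrix [Q] makes [invmx Q *m jacobian_mx F x] a one-sided inverse of the transposed
   Jacobian, which acts on row vectors from the right. *)
pose v := (- theta) *m invmx Q *m jacobian_mx F x.
have DF : 'D_v F x = - theta.
  rewrite deriveEjacobian// -[jacobian F x]trmxK -/(jacobian_mx F x).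
  by rewrite -!mulmxA mulVmx// mulmx1.
have Fneg : (h^-1 * dotp theta (F (h *: v + x))) @[h --> 0^'] --> - dotp theta theta.
  have dF : derivable F x v by exact: diff_derivable.
  have := cvg_comp _ (dotp theta) dF (@continuous_dotpr _ _ theta _).
  rewrite -/('D_v F x) DF dotpC dotpNl; apply: cvg_trans.
  by apply: near_eq_cvg; near=> h => /=; rewrite Fx0 subr0 dotpC dotpZl dotpC.
apply: mu_gt0.
  have cFt : continuous (fun y => dotp (F y) theta).
    by apply: (@continuous_dotp _ _ _ F (cst theta)) => // y; exact: cst_continuous.
  exact: (open_comp (fun y _ => cFt y) (@open_lt R 0)).
have lt0 : - dotp theta theta < 0 by rewrite oppr_lt0 dotp_gt0.
(* Only positive [h] are kept, so that the quotient and [dotp theta (F (h *: v + x))] have the same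
   sign. *)
have : \forall h \near 0^'+, h^-1 * dotp theta (F (h *: v + x)) < 0.
  exact: (cvgr_lt _ (cvg_dnbhs_at_right Fneg)).

move=> neg; near (0 : R)^'+ => h.
exists (h *: v + x : 'rV[R]_d) => /=.
have h0 : 0 < h by near: h; exact: nbhs_right_gt.
have : h^-1 * dotp theta (F (h *: v + x)) < 0 by near: h.
by rewrite dotpC pmulr_rlt0 ?invr_gt0.
Unshelve. all: by end_near. Qed.

(** * Relative entropy and densities *)

(* a ln (a / b) - a + b, which is b at a = 0 since ln 0 = 0. *)
Definition entropy_gap (R : realType) (a b : R) : R := a * ln a - a * ln b - a + b.

(** For a > 0 the gap is a (exp w - 1 - w) with w = ln (b / a), so both the sign and the equality
    case come from exp w >= 1 + w, strict unless w = 0. At a = 0 the gap is b > 0. *)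
Lemma entropy_gap_ge0 (R : realType) (a b : R) :
  0 <= a -> 0 < b -> 0 <= entropy_gap a b ?= iff (a == b).
Proof.
rewrite /entropy_gap le_eqVlt => /predU1P[<- b0|a0 b0].
  by split; rewrite !mul0r subr0 sub0r oppr0 add0r ?ltW// eq_sym.
have -> : a * ln a - a * ln b - a + b = a * (expR (ln (b / a)) - (1 + ln (b / a))).
  rewrite lnK ?posrE ?divr_gt0// lnM ?posrE ?invr_gt0// lnV ?posrE//.
  by field; rewrite gt_eqF.
split; first by rewrite mulr_ge0 ?(ltW a0)// subr_ge0 expR_ge1Dx.
apply/eqP/eqP => [/eqP|<-]; last first.
  by rewrite divff ?gt_eqF// ln1 expR0 addr0 subrr mulr0.
rewrite eq_sym mulf_eq0 gt_eqF//= subr_eq0 => /eqP e.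
have /eqP : ln (b / a) == 0.
  by apply: contraT => /expR_gt1Dx; rewrite e ltxx.
move/(congr1 (@expR R)); rewrite lnK ?posrE ?divr_gt0// expR0 => /divr1_eq ->//.
Qed.

(* Unlike in integralD, h need not be integrable. *)
Lemma ge0_integrable_integralD d (T : measurableType d) (R : realType)
    (mu : {measure set T -> \bar R}) (h k : T -> R) :
  measurable_fun [set: T] h -> (forall x, 0 <= h x) ->
  mu.-integrable setT (EFin \o k) ->
  (\int[mu]_x (h x + k x)%:E = \int[mu]_x (h x)%:E + \int[mu]_x (k x)%:E)%E.
Proof.
move=> mh h0 ik.
have emh : measurable_fun [set: T] (EFin \o h) by apply/measurable_EFinP.
have mk := measurable_int _ ik.
have [hoo|hoo] := ltP (\int[mu]_x (h x)%:E)%E +oo%E.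
  have ih : mu.-integrable setT (EFin \o h).
    apply/integrableP; split => //.
    by under eq_integral do rewrite gee0_abs ?lee_fin//.
  by under eq_integral do rewrite EFinD; rewrite integralD.
(* If h has infinite integral, so has h + k: its negative part is dominated by |k|, and a finite
   positive part would bound the integral of h through h <= (h + k)^+ + |k|. *)
move: hoo; rewrite leye_eq => /eqP hoo; rewrite hoo addye; last first.
  by rewrite gt_eqF// ltNye_eq integrable_fin_num.
pose f x := (h x + k x)%:E.
have mf : measurable_fun [set: T] f.
  by rewrite /f; under eq_fun do rewrite EFinD; exact: emeasurable_funD.
have fnoo : (\int[mu]_x f^\- x < +oo)%E.
  apply: le_lt_trans (integrable_lty measurableT (integrable_abse ik)).
  apply: ge0_le_integral => //=.
  - exact: measurable_funeneg.
  - exact: measurable_int (integrable_abse ik).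
  move=> x _; rewrite funenegE /f -EFinN ge_max !lee_fin normr_ge0 andbT.
  by rewrite -normrN (le_trans _ (ler_norm _))// lerN2 lerDr.
have fpoo : (\int[mu]_x f^\+ x = +oo)%E.
  apply/eqP; rewrite -leye_eq leNgt; apply/negP => fp.
  suff : (\int[mu]_x (h x)%:E < +oo)%E by rewrite hoo ltxx.
  apply: (@le_lt_trans _ _ (\int[mu]_x (f^\+ x + `|(k x)%:E|))%E).
    apply: ge0_le_integral => //.
    - by move=> x _; rewrite lee_fin.
    - apply: emeasurable_funD; first exact: measurable_funepos.
      exact: measurable_int (integrable_abse ik).
    - move=> x _; apply: (@le_trans _ _ (f x + `|(k x)%:E|)%E).
        by rewrite lee_fin -addrA lerDl -lerBlDl sub0r -normrN ler_norm.
      by rewrite leeD2r// funeposE le_max lexx.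
  rewrite ge0_integralD//=.
  - by rewrite lte_add_pinfty//; exact: integrable_lty (integrable_abse ik).
  - exact: measurable_funepos.
  - exact: measurable_int (integrable_abse ik).
by rewrite -/f integralE fpoo addye// eqe_oppLR/= (lt_eqF fnoo).
Qed.

(** * The Gibbs variational principle for a positive density *)

Section gibbs_variational_principle.
Local Open Scope charge_scope.
Context d (T : measurableType d) (R : realType).
Variables (mu nu : probability T R) (g : T -> R).
Hypothesis numu : nu `<< mu.
Hypothesis mg : measurable_fun [set: T] g.
Hypothesis g_gt0 : forall x, 0 < g x.
Hypothesis g1 : (\int[mu]_x (g x)%:E = 1)%E.
Hypothesis ig : nu.-integrable [set: T] (fun x => (ln (g x))%:E).

Let f := ('d (charge_of_finite_measure nu) '/d mu).

(* The library derivative may be negative on a null set; f0 is a nonnegative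
   version of it. *)
Let f0 x := fine (Radon_Nikodym_SigmaFinite.f nu mu x).

Let f0E x : (f0 x)%:E = Radon_Nikodym_SigmaFinite.f nu mu x.
Proof. by rewrite fineK// Radon_Nikodym_SigmaFinite.f_fin_num. Qed.

Let f0_ge0 x : 0 <= f0 x.
Proof. by rewrite fine_ge0// Radon_Nikodym_SigmaFinite.f_ge0. Qed.

Let int_f0 : mu.-integrable [set: T] (EFin \o f0).
Proof.
apply: eq_integrable (Radon_Nikodym_SigmaFinite.f_integrable numu) => // x _.
by rewrite -f0E.
Qed.

Let f0f : ae_eq mu setT (EFin \o f0) f.
Proof.
have := ae_eq_Radon_Nikodym_SigmaFinite numu measurableT.
by apply: filterS => x /[apply]; rewrite -f0E.
Qed.

Let mf0 : measurable_fun [set: T] f0.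
Proof. by apply/measurable_EFinP; exact: measurable_int int_f0. Qed.

Let mf : measurable_fun [set: T] f.
Proof. by apply: measurable_int; exact: Radon_Nikodym_integrable. Qed.

(** The integrable remainder in f0 ln f0 = [entropy_gap f0 g] + k. The terms f0 and g both have
    total mass 1 and cancel in its integral. *)
Let k x := f0 x * ln (g x) + f0 x - g x.

Let int_k : mu.-integrable setT (EFin \o k) /\
  (\int[mu]_x (k x)%:E = \int[nu]_x (ln (g x))%:E)%E.
Proof.
have mlg : measurable_fun [set: T] (fun x => ln (g x)) by exact: measurableT_comp.
have ifl : mu.-integrable setT (fun x => (f0 x * ln (g x))%:E).
  have := Radon_Nikodym_SigmaFinite.integrableM numu _ measurableT
    (integrable_abse ig).
  move=> /(_ (fun x => abse_ge0 _)); apply: le_integrable => //.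
    by apply/measurable_EFinP; exact: measurable_funM.
  move=> x _ /=; rewrite -f0E -EFinM !abse_EFin !normrM normr_id.
  by rewrite mulrC.
have ig' : mu.-integrable setT (EFin \o g).
  apply/integrableP; split; first exact/measurable_EFinP.
  under eq_integral do rewrite gee0_abs ?lee_fin ?(ltW (g_gt0 _))//.
  by rewrite g1 ltry.
have if1 := integrableD measurableT ifl int_f0.
split.
  apply: eq_integrable (integrableB measurableT if1 ig') => //.
under eq_integral do rewrite EFinB EFinD.
rewrite integralB// integralD//.
have -> : (\int[mu]_x (f0 x)%:E = 1)%E.
  rewrite -(probability_setT nu) (Radon_Nikodym_SigmaFinite.f_integral numu)//.
  by apply: eq_integral => x _; rewrite f0E.
rewrite g1 addeK//.
rewrite -(Radon_Nikodym_change_of_variables numu)//.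
apply: ae_eq_integral => //.
- exact: measurable_int ifl.
- by apply: emeasurable_funM; [exact: measurable_int ig|exact: mf].
by apply: filterS f0f => x /[apply] fx; rewrite -/(f x) -fx EFinM muleC.
Qed.

(** The entropy may be infinite, so the gap is only known to be nonnegative;
    [ge0_integrable_integralD] splits the sum without its integrability. *)
Let relative_entropyE :
  (\int[mu]_x (fine (f x) * ln (fine (f x)))%:E =
   \int[mu]_x (entropy_gap (f0 x) (g x))%:E + \int[nu]_x (ln (g x))%:E)%E.
Proof.
have [ik <-] := int_k.
have mln (h : T -> R) : measurable_fun [set: T] h ->
    measurable_fun [set: T] (fun x => ln (h x)).
  by move=> mh; exact: measurableT_comp.
rewrite -ge0_integrable_integralD//; last 2 first.
- apply: measurable_funD => //; apply: measurable_funB => //.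
  by apply: measurable_funB => //; apply: measurable_funM => //; exact: mln.
- by move=> x; rewrite entropy_gap_ge0.
apply: ae_eq_integral => //.
- have mff : measurable_fun [set: T] (fun x => fine (f x)).
    exact: measurableT_comp.
  by apply/measurable_EFinP; apply: measurable_funM => //; exact: mln.
- apply/measurable_EFinP; apply: measurable_funD.
    apply: measurable_funD => //; apply: measurable_funB => //.
    by apply: measurable_funB => //; apply: measurable_funM => //; exact: mln.
  by apply/measurable_EFinP; exact: measurable_int ik.
apply: filterS f0f => x /[apply] <- /=; congr EFin.
by rewrite /entropy_gap /k; ring.
Qed.

Let gap_ge0 x : (0 <= (entropy_gap (f0 x) (g x))%:E)%E.
Proof. by rewrite lee_fin entropy_gap_ge0. Qed.

Let mgap : measurable_fun [set: T] (fun x => (entropy_gap (f0 x) (g x))%:E).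
Proof.
have mln (h : T -> R) : measurable_fun [set: T] h ->
    measurable_fun [set: T] (fun x => ln (h x)).
  by move=> mh; exact: measurableT_comp.
apply/measurable_EFinP; apply: measurable_funD => //; apply: measurable_funB => //.
by apply: measurable_funB => //; apply: measurable_funM => //; exact: mln.
Qed.

Lemma integral_ln_le_relative_entropy :
  (\int[nu]_x (ln (g x))%:E <=
   \int[mu]_x (fine (('d (charge_of_finite_measure nu) '/d mu) x) *
               ln (fine (('d (charge_of_finite_measure nu) '/d mu) x)))%:E)%E.
Proof. by rewrite relative_entropyE leeDr// integral_ge0. Qed.

(** The integral of ln g under [nu] is finite and cancels, so equality means that the gap has
    integral zero; being nonnegative it then vanishes almost everywhere, which forces f0 = g. *)
Lemma relative_entropy_eq_integral_ln :
  (\int[mu]_x (fine (('d (charge_of_finite_measure nu) '/d mu) x) *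
               ln (fine (('d (charge_of_finite_measure nu) '/d mu) x)))%:E =
   \int[nu]_x (ln (g x))%:E)%E <->
  ae_eq mu setT ('d (charge_of_finite_measure nu) '/d mu) (EFin \o g).
Proof.
rewrite relative_entropyE; split=> [gap0|fg].
  have {}gap0 : (\int[mu]_x (entropy_gap (f0 x) (g x))%:E = 0)%E.
    have lg : (\int[nu]_x (ln (g x))%:E)%E \is a fin_num.
      by rewrite integrable_fin_num.
    by rewrite -(addeK (\int[mu]_x (entropy_gap (f0 x) (g x))%:E) lg)%E gap0 subee.
  have /(ae_eq_integral_abs mu measurableT mgap) : 
    (\int[mu]_x `|(entropy_gap (f0 x) (g x))%:E| = 0)%E.
    by rewrite -[RHS]gap0; apply: eq_integral => x _; rewrite gee0_abs.
  move=> gap_ae0; apply: filterS2 f0f gap_ae0 => x f0x gapx _.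
  rewrite -[LHS](f0x I) /=; have /eqP := gapx I; rewrite -[cst 0%E x]/(0%:E) eqe.
  by rewrite eq_sym entropy_gap_ge0// => /eqP ->.
rewrite (_ : (\int[mu]_x (entropy_gap (f0 x) (g x))%:E = 0)%E) ?add0e//.
rewrite -(@integral0 _ _ _ mu [set: T]); apply: ae_eq_integral => //.
move: f0f fg; apply: filterS2 => x f0x fx _.
have := fx I; rewrite -[LHS](f0x I) => -[->].
by congr EFin; rewrite /entropy_gap; ring.
Qed.

End gibbs_variational_principle.

(** * Probability measures with a prescribed density *)

Section measure_with_density.
Local Open Scope charge_scope.
Context d (T : measurableType d) (R : realType).
Variables (mu : probability T R) (g : T -> R).
Hypothesis mg : measurable_fun [set: T] g.
Hypothesis g_ge0 : forall x, 0 <= g x.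
Hypothesis g1 : (\int[mu]_x (g x)%:E = 1)%E.

Definition density_prob : set T -> \bar R := fun A => (\int[mu]_(x in A) (g x)%:E)%E.

Let density_prob0 : density_prob set0 = 0%E.
Proof. by rewrite /density_prob integral_set0. Qed.

Let density_prob_ge0 A : (0 <= density_prob A)%E.
Proof. by apply: integral_ge0 => x _; rewrite lee_fin. Qed.

Let density_prob_sigma_additive : semi_sigma_additive density_prob.
Proof.
apply: semi_sigma_additive_nng_induced => [|x]; last by rewrite lee_fin.
exact/measurable_EFinP.
Qed.

HB.instance Definition _ := isMeasure.Build _ _ _
  density_prob density_prob0 density_prob_ge0 density_prob_sigma_additive.

Let density_prob_setT : density_prob [set: T] = 1%E.
Proof. exact: g1. Qed.

HB.instance Definition _ := Measure_isProbability.Build _ _ _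
  density_prob density_prob_setT.

(** The derivative of [density_prob] and g have the same integral over every measurable set, hence
    agree almost everywhere. *)
Lemma exists_probability_density : exists nu : probability T R,
  nu `<< mu /\
  ae_eq mu setT ('d (charge_of_finite_measure nu) '/d mu) (EFin \o g).
Proof.
have gmu : density_prob `<< mu.
  apply/null_content_dominatesP => A mA muA; apply: null_set_integral => //.
  by apply: measurable_funTS; exact/measurable_EFinP.
exists density_prob; split => //.
apply: integral_ae_eq => //.
- by apply: Radon_Nikodym_integrable.
- exact/measurable_EFinP.
by move=> E _ mE; rewrite -Radon_Nikodym_integral.
Qed.

End measure_with_density.

Section density.
Local Open Scope charge_scope.
Context d (T : measurableType d) (R : realType).
Variables (mu nu : probability T R) (g : T -> R).
Hypothesis numu : nu `<< mu.
Hypothesis nug : ae_eq mu setT ('d (charge_of_finite_measure nu) '/d mu) (EFin \o g).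

Lemma density_integrable (h : T -> R) : measurable_fun [set: T] h ->
  mu.-integrable setT (fun x => (h x * g x)%:E) ->
  nu.-integrable setT (fun x => (h x)%:E).
Proof.
move=> mh /integrableP[mhg hgoo].
have mah : measurable_fun [set: T] (fun x => `|(h x)%:E|%E).
  by apply: measurableT_comp => //; exact/measurable_EFinP.
apply/integrableP; split; first exact/measurable_EFinP.
rewrite -(Radon_Nikodym_SigmaFinite.change_of_variables numu)//.
rewrite (ae_eq_integral (fun x => `|(h x * g x)%:E|%E))//.
- apply: emeasurable_funM => //.
  exact: measurable_int (Radon_Nikodym_SigmaFinite.f_integrable numu).
- by apply: measurableT_comp => //; exact: measurable_int mhg.
have := ae_eq_Radon_Nikodym_SigmaFinite numu measurableT.
move: nug; apply: filterS2 => x gx fx _.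
rewrite EFinM abseM -[(g x)%:E](gx I) -fx//; congr (_ * _)%E; rewrite gee0_abs//.
exact: Radon_Nikodym_SigmaFinite.f_ge0.
Qed.

Lemma density_integral (h : T -> R) : measurable_fun [set: T] h ->
  mu.-integrable setT (fun x => (h x * g x)%:E) ->
  (\int[nu]_x (h x)%:E = \int[mu]_x (h x * g x)%:E)%E.
Proof.
move=> mh ihg; rewrite -(Radon_Nikodym_change_of_variables numu)//; last first.
  exact: density_integrable.
apply: ae_eq_integral => //.
- apply: emeasurable_funM; first exact/measurable_EFinP.
  by apply: measurable_int; exact: Radon_Nikodym_integrable.
- exact: measurable_int ihg.
by move: nug; apply: filterS => x /[apply] gx; rewrite gx EFinM.
Qed.

(** This gives uniqueness in (P): two measures with the same density agree on measurable sets. *)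
Lemma density_measure A : measurable_fun [set: T] g -> measurable A ->
  nu A = (\int[mu]_(x in A) (g x)%:E)%E.
Proof.
move=> mg mA; rewrite -[LHS]/(charge_of_finite_measure nu A).
rewrite (Radon_Nikodym_integral (mu := mu))//; apply: ae_eq_integral => //.
- by apply: measurable_funTS; apply: measurable_int; exact: Radon_Nikodym_integrable.
- by apply: measurable_funTS; exact/measurable_EFinP.
by move: nug; apply: filterS => x gx _; exact: gx.
Qed.

End density.

(** * Minimizing the partition function *)

(** For b <= a, exp a - exp b = (1 - exp (b - a)) exp a <= (a - b) exp a. Adding exp b makes the
    bound symmetric. *)
Lemma expR_lipschitz (R : realType) (a b : R) :
  `|expR a - expR b| <= `|a - b| * (expR a + expR b).
Proof.
wlog ab : a b / b <= a.
  move=> H; have [|/ltW] := leP b a; first exact: H.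
  by rewrite distrC (distrC a) (addrC (expR a)); exact: H.
rewrite !ger0_norm ?subr_ge0 ?ler_expR//.
apply: (@le_trans _ _ ((a - b) * expR a)); last first.
  by rewrite ler_wpM2l ?subr_ge0// lerDl expR_ge0.
have -> : expR a - expR b = (1 - expR (b - a)) * expR a.
  by rewrite mulrBl -expRD subrK mul1r.
rewrite ler_wpM2r ?expR_ge0// lerBlDr -lerBlDl opprB.
by apply: le_trans (expR_ge1Dx _); rewrite lexx.
Qed.

(** Everything follows from (1 - w) exp w <= 1. If w >= 0, it reads exp w - 1 <= w exp w, used
    twice; if w < 0, it gives exp w <= 1 / (1 - w) <= 1 + w + w^2. *)
Lemma expR_le_quadratic (R : realType) (w : R) :
  expR w <= 1 + w + w ^+ 2 * expR `|w|.
Proof.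
have e1 : expR w * (1 - w) <= 1.
  rewrite -ler_pdivlMl ?expR_gt0// mulr1 -expRN.
  exact: expR_ge1Dx.
have e2 := expR_ge1Dx w.
have [w0|w0] := leP 0 w.
  rewrite ger0_norm//.
  have : w * (expR w - 1) <= w * (w * expR w) by rewrite ler_wpM2l//; lra.
  rewrite expr2; lra.
have : 1 <= expR `|w| by rewrite -expR0 ler_expR.
rewrite expr2; nra.
Qed.

Lemma locally_lipschitz_continuous (R : realType) (V : normedModType R)
    (f : V -> R) :
  (forall r, exists M, forall u v, `|u| <= r -> `|v| <= r ->
    `|f u - f v| <= M * `|u - v|) -> continuous f.
Proof.
move=> lipf u; have [M lipM] := lipf (`|u| + 1).
apply/cvgrPdist_lt => e e0.
have M0 : 0 < `|M| + 1 by rewrite ltr_wpDl.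
near=> v.
have uv1 : `|u - v| < 1 by near: v; apply: cvgr_dist_lt => //; exact: ltr01.
have uve : `|u - v| < e / (`|M| + 1).
  by near: v; apply: cvgr_dist_lt => //; rewrite divr_gt0.
apply: (@le_lt_trans _ _ (M * `|u - v|)).
  apply: lipM; first by rewrite lerDl.
  by rewrite -[v](subrK u) (le_trans (ler_normD _ _))// addrC lerD2l distrC ltW.
apply: (@le_lt_trans _ _ ((`|M| + 1) * `|u - v|)).
  by rewrite ler_wpM2r// (le_trans (ler_norm _))// lerDl.
by rewrite mulrC -ltr_pdivlMr.
Unshelve. all: by end_near. Qed.

(** * Compactness and minimization of coercive functions *)

Section closed_balls.
Context (R : realType) (n : nat).

Lemma compact_sphere (r : R) : compact [set u : 'rV[R]_n | `|u| = r].
Proof.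
apply: bounded_closed_compact.
  exists r; split; first exact: num_real.
  by move=> M rM u /= ->; exact: ltW.
rewrite (_ : mkset _ = (fun u : 'rV[R]_n => `|u|) @^-1` [set r])//.
apply: closed_comp => [u _|]; first exact: norm_continuous.
exact: closed_eq.
Qed.

Lemma compact_norm_le (r : R) : compact [set u : 'rV[R]_n | `|u| <= r].
Proof.
apply: bounded_closed_compact.
  exists r; split; first exact: num_real.
  by move=> M rM u /= ur; exact: le_trans (ltW rM).
apply: (@closed_comp _ _ (fun u : 'rV[R]_n => `|u|) [set t | t <= r]) => [u _|].
  exact: norm_continuous.
exact: closed_le.
Qed.

(* A homogeneous minorant that is positive on the unit sphere makes a
   continuous function coercive. *)
Lemma continuous_coercive_min (f phi : 'rV[R]_n -> R) :
  continuous f -> continuous phi ->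
  (forall u, phi u <= f u) ->
  (forall a u, 0 <= a -> phi (a *: u) = a * phi u) ->
  (forall u, u != 0 -> 0 < phi u) ->
  exists u, forall v, f u <= f v.
Proof.
move=> cf cphi phif phiZ phi_gt0; pose S := [set u : 'rV[R]_n | `|u| = 1].
have normalize u : u != 0 -> S (`|u|^-1 *: u).
  by move=> u0; rewrite /S/= normrZ normfV normr_id mulVf// normr_eq0.
(* In dimension zero the sphere is empty and the origin is the only point. *)
have [[u Su]|S0] := pselect (S !=set0); last first.
  exists 0 => v; have [->//|v0] := eqVneq v 0.
  by exfalso; apply: S0; exists (`|v|^-1 *: v); exact: normalize.
have cS : {within S, continuous phi} by exact: continuous_subspaceT.
have [s Ss phis] := EVT_min_rV (ex_intro _ u Su) (@compact_sphere 1) cS.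
have c0 : 0 < phi s.
  apply: phi_gt0; apply/eqP => s0; move: Ss.
  by rewrite inE/= s0 normr0 => /eqP; rewrite eq_sym oner_eq0.
have lower v : phi s * `|v| <= f v.
  apply: le_trans (phif v); have [->|v0] := eqVneq v 0.
    by rewrite normr0 mulr0; have := phiZ 0 0 (lexx 0); rewrite scale0r mul0r => ->.
  rewrite -[in leRHS](scale1r v) -(@mulfV _ `|v|) ?normr_eq0//.
  rewrite -scalerA phiZ// mulrC ler_wpM2l//.
  by apply: phis; rewrite inE; exact: normalize.
(* Beyond this radius the lower bound [phi s * |v|] exceeds [f 0], so a minimum over the ball is
   global. *)
pose r := f 0 / phi s.
have r0 : 0 <= r.
  by rewrite divr_ge0 ?(ltW c0)//; have := lower 0; rewrite normr0 mulr0.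
have cB : {within [set u : 'rV[R]_n | `|u| <= r], continuous f}.
  exact: continuous_subspaceT.
have B0 : [set u : 'rV[R]_n | `|u| <= r] 0 by rewrite /= normr0.
have [m _ mmin] := EVT_min_rV (ex_intro _ 0 B0) (@compact_norm_le r) cB.
exists m => v; have [vr|rv] := leP `|v| r; first by apply: mmin; rewrite inE.
apply: (@le_trans _ _ (f 0)); first by apply: mmin; rewrite inE.
apply: le_trans (lower v); rewrite -ler_pdivrMl// mulrC.
exact: ltW.
Qed.

End closed_balls.

(** * Functions dominated by a weight with all exponential moments *)

Section exponential_moments.
Context d (T : measurableType d) (R : realType).
Variables (mu : probability T R) (N : T -> R).
Hypothesis mN : measurable_fun [set: T] N.
Hypothesis N_ge0 : forall x, 0 <= N x.
Hypothesis expN : forall c, mu.-integrable setT (fun x => (expR (c * N x))%:E).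

Lemma le_exp_integrable (f : T -> R) c : measurable_fun [set: T] f ->
  (forall x, `|f x| <= expR (c * N x)) -> mu.-integrable setT (EFin \o f).
Proof.
move=> mf fN; apply: le_integrable (expN c) => //; first exact/measurable_EFinP.
by move=> x _ /=; rewrite lee_fin [leRHS]ger0_norm ?expR_ge0.
Qed.

Lemma le_expR_mul c x : N x * expR (c * N x) <= expR ((c + 1) * N x).
Proof.
rewrite mulrDl mul1r expRD mulrC ler_wpM2l ?expR_ge0//.
by apply: le_trans (expR_ge1Dx _); rewrite lerDr.
Qed.

(* First-order optimality at t = 0, obtained from the quadratic upper bound on
   expR so that no differentiation under the integral is needed. *)
Lemma integral_eq0_exp_ge1 (G : T -> R) : measurable_fun [set: T] G ->
  (forall x, `|G x| <= N x) ->
  (forall t, 1 <= \int[mu]_x expR (t * G x)) -> \int[mu]_x G x = 0.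
Proof.
move=> mG GN ge1.
have GeN x : `|G x| <= expR (1 * N x).
  by rewrite mul1r (le_trans (GN x))// (le_trans _ (expR_ge1Dx _))// lerDr.
have iG : mu.-integrable setT (EFin \o G) by exact: le_exp_integrable GeN.
have mE : measurable_fun [set: T] (fun x => G x ^+ 2 * expR `|G x|).
  apply: measurable_funM; first exact: measurable_funX.
  by do 2 apply: measurableT_comp => //.
have iE : mu.-integrable setT (EFin \o (fun x => G x ^+ 2 * expR `|G x|)).
  apply: (@le_exp_integrable _ 3) => // x.
  rewrite normrM normrX (ger0_norm (expR_ge0 _)) expr2.
  (* One N for each of the two factors |G| <= exp N, and one for exp |G| <= exp N. *)
  rewrite (_ : 3 * N x = N x + N x + N x); last by ring.
  rewrite !expRD; apply: ler_pM; rewrite ?mulr_ge0 ?expR_ge0 ?ler_expR//.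
  by apply: ler_pM => //; rewrite -[N x]mul1r; exact: GeN.
set E := \int[mu]_x (G x ^+ 2 * expR `|G x|).
(* The quadratic bound at w = t G is integrated; |t| <= 1 allows exp |t G| to be replaced by exp
   |G|, so that [E] does not depend on t. *)
have bound t : `|t| <= 1 -> 0 <= t * \int[mu]_x G x + t ^+ 2 * E.
  move=> t1; have := ge1 t.
  have i1 : mu.-integrable setT (EFin \o cst (1 : R)).
    exact: finite_measure_integrable_cst.
  have itG : mu.-integrable setT (EFin \o (fun x => t * G x)).
    by apply: eq_integrable (integrableZl measurableT t iG).
  have itE : mu.-integrable setT
      (EFin \o (fun x => t ^+ 2 * (G x ^+ 2 * expR `|G x|))).
    by apply: eq_integrable (integrableZl measurableT (t ^+ 2) iE).
  have i1G : mu.-integrable setT (EFin \o (fun x => 1 + t * G x)).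
    by apply: eq_integrable (integrableD measurableT i1 itG).
  have iall : mu.-integrable setT
      (EFin \o (fun x => 1 + t * G x + t ^+ 2 * (G x ^+ 2 * expR `|G x|))).
    by apply: eq_integrable (integrableD measurableT i1G itE).
  have itexp : mu.-integrable setT (EFin \o (fun x => expR (t * G x))).
    apply: (@le_exp_integrable _ 1).
      by apply: measurableT_comp => //; exact: measurable_funM.
    move=> x; rewrite ger0_norm ?expR_ge0// ler_expR mul1r (le_trans (ler_norm _))//.
    by rewrite normrM (le_trans _ (GN x))// ler_piMl.
  have : \int[mu]_x expR (t * G x) <=
      \int[mu]_x (1 + t * G x + t ^+ 2 * (G x ^+ 2 * expR `|G x|)).
    apply: le_Rintegral => // x _; apply: le_trans (expR_le_quadratic _) _.
    rewrite lerD2l exprMn -mulrA; apply: ler_wpM2l; first exact: sqr_ge0.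
    by rewrite ler_wpM2l ?sqr_ge0// ler_expR normrM ler_piMl.
  rewrite RintegralD// RintegralD// !RintegralZl// Rintegral_cst//=.
  rewrite probability_setT/= -/E.
  lra.
have E0 : 0 <= E by apply: Rintegral_ge0 => x _; rewrite mulr_ge0 ?sqr_ge0 ?expR_ge0.
set I := \int[mu]_x G x in bound *.
have pos_bound (s t : R) : `|s| = 1 -> 0 < t <= 1 -> 0 <= s * I + t * E.
  move=> s1 /andP[t0 t1]; have := bound (t * s).
  rewrite normrM s1 mulr1 gtr0_norm// => /(_ t1).
  rewrite exprMn -(real_normK (num_real s)) s1 expr1n mulr1.
  have -> : t * s * I + t ^+ 2 * E = t * (s * I + t * E) by ring.
  by rewrite pmulr_rge0.
have sI s : `|s| = 1 -> 0 <= s * I.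
  move=> s1; rewrite leNgt; apply/negP => sI0.
  (* With this t, t E is less than - s I, against [pos_bound]. The 1 added to E keeps the
     denominator positive, and the minimum keeps t in the admissible range. *)
  pose t := Num.min 1 (- (s * I) / (2 * (E + 1))).
  have t0 : 0 < t by rewrite lt_min ltr01 divr_gt0 ?oppr_gt0//; lra.
  have := pos_bound _ t s1; rewrite t0 ge_min lexx => /(_ isT).
  have : t * (2 * (E + 1)) <= - (s * I).
    by rewrite -ler_pdivlMr ?ge_min ?lexx ?orbT//; lra.
  nra.
apply/eqP; rewrite eq_le -oppr_ge0 -mulN1r sI ?normrN1//=.
by rewrite -[I]mul1r sI// normr1.
Qed.

End exponential_moments.

(** * Positivity, continuity and minimum of the partition function *)

Section partition_function.
Context d (T : measurableType d) (R : realType) (p : nat).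
Variables (mu : probability T R) (N : T -> R) (F : T -> 'rV[R]_p).
Hypothesis mN : measurable_fun [set: T] N.
Hypothesis N_ge0 : forall x, 0 <= N x.
Hypothesis expN : forall c, mu.-integrable setT (fun x => (expR (c * N x))%:E).
Hypothesis mF : forall u, measurable_fun [set: T] (fun x => dotp u (F x)).
Hypothesis FN : forall x i, `|F x 0 i| <= N x.

Let Z u := \int[mu]_x expR (- dotp u (F x)).

Let phi u := \int[mu]_x Num.max 0 (- dotp u (F x)).

Lemma normr_dotp_le_bound u x : `|dotp u (F x)| <= p%:R * `|u| * N x.
Proof. exact: normr_dotp_le. Qed.

Lemma exp_dotp_le u x : expR (- dotp u (F x)) <= expR (p%:R * `|u| * N x).
Proof.
by rewrite ler_expR (le_trans (ler_norm _))// normrN normr_dotp_le_bound.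
Qed.

Lemma exp_dotp_integrable u :
  mu.-integrable setT (EFin \o (fun x => expR (- dotp u (F x)))).
Proof.
apply: (le_exp_integrable expN (c := p%:R * `|u|)) => [|x].
  by apply: measurableT_comp => //; exact: measurable_funN.
by rewrite ger0_norm ?expR_ge0// exp_dotp_le.
Qed.

Let mphi u : measurable_fun [set: T] (fun x => Num.max 0 (- dotp u (F x))).
Proof. by apply: measurable_maxr => //; exact: measurable_funN. Qed.

Let iphi u : mu.-integrable setT (EFin \o (fun x => Num.max 0 (- dotp u (F x)))).
Proof.
apply: (le_exp_integrable expN (c := p%:R * `|u|)) => [|x]; first exact: mphi.
rewrite ger0_norm ?le_max ?lexx// ge_max expR_ge0/=.
apply: le_trans (expR_ge1Dx _); rewrite (le_trans (ler_norm _))// normrN.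
by rewrite (le_trans (normr_dotp_le_bound _ _))// lerDr.
Qed.

Let iN : mu.-integrable setT (EFin \o N).
Proof.
apply: (le_exp_integrable expN (c := 1)) => // x.
by rewrite mul1r ger0_norm// (le_trans _ (expR_ge1Dx _))// lerDr.
Qed.

(** Shared by [Z] and [phi]: an integrable Lipschitz constant of the integrand integrates to one for
    the integral. *)
Let lipschitz_of_integrand (f : 'rV[R]_p -> T -> R) (W : T -> R) (u v : 'rV[R]_p) :
  mu.-integrable setT (EFin \o f u) -> mu.-integrable setT (EFin \o f v) ->
  mu.-integrable setT (EFin \o W) ->
  (forall x, `|f u x - f v x| <= `|u - v| * W x) ->
  `|\int[mu]_x f u x - \int[mu]_x f v x| <= (\int[mu]_x W x) * `|u - v|.
Proof.
move=> iu iv iW lip; rewrite -RintegralB//.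
have iuv : mu.-integrable setT (EFin \o (fun x => f u x - f v x)).
  by apply: eq_integrable (integrableB measurableT iu iv).
apply: le_trans (le_normr_Rintegral _ _) _ => //.
rewrite mulrC -RintegralZl//; apply: le_Rintegral => //.
- by apply: eq_integrable (integrable_abse iuv).
- by apply: eq_integrable (integrableZl measurableT `|u - v| iW).
Qed.

(** A positive function with zero integral would make the whole space a null set. *)
Lemma partition_function_gt0 u : 0 < Z u.
Proof.
rewrite lt_neqAle Rintegral_ge0 ?andbT => [|x _]; last exact: expR_ge0.
apply/eqP => Z0.
have iZ := exp_dotp_integrable u.
have : ae_eq mu setT (EFin \o (fun x => expR (- dotp u (F x)))) (cst 0%E).
  apply/(ae_eq_integral_abs _ measurableT); first exact: measurable_int iZ.
  under eq_integral do rewrite gee0_abs ?lee_fin ?expR_ge0//.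
  by rewrite -[LHS]fineK ?integrable_fin_num//; congr EFin; exact: esym Z0.
move=> [B [mB B0 sB]]; have : (mu setT <= mu B)%E.
  apply: le_measure; rewrite ?inE// => x _; apply: sB => /= /(_ I) [] /eqP.
  by rewrite gt_eqF// expR_gt0.
by rewrite B0 probability_setT lee_fin ler10.
Qed.

Lemma partition_function_continuous : continuous Z.
Proof.
apply: locally_lipschitz_continuous => r.
(* The 2 counts the two exponentials in [expR_lipschitz], each at most exp (p r N); the factor N
   from |<u - v, F>| is absorbed by raising the exponent by N. *)
exists (\int[mu]_x (p%:R * 2 * expR ((p%:R * r + 1) * N x))) => u v ur vr.
apply: (@lipschitz_of_integrand (fun u x => expR (- dotp u (F x)))).
- exact: exp_dotp_integrable.
- exact: exp_dotp_integrable.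
- by apply: eq_integrable (integrableZl measurableT (p%:R * 2)
    (expN (p%:R * r + 1))).
move=> x; apply: le_trans (expR_lipschitz _ _) _.
have er w : `|w| <= r -> expR (- dotp w (F x)) <= expR (p%:R * r * N x).
  move=> wr; apply: le_trans (exp_dotp_le _ _) _; rewrite ler_expR.
  by rewrite ler_wpM2r// ler_wpM2l.
apply: (@le_trans _ _ ((p%:R * `|u - v| * N x) * (expR (p%:R * r * N x) * 2))).
  apply: ler_pM; rewrite ?addr_ge0 ?expR_ge0//.
    rewrite -normrN opprB opprK addrC -dotpBl; exact: normr_dotp_le_bound.
  by rewrite mulrDr mulr1 lerD// er.
rewrite (_ : _ * _ = `|u - v| * (p%:R * 2 * (N x * expR (p%:R * r * N x))));
  last by ring.
by rewrite ler_wpM2l// ler_wpM2l ?mulr_ge0// le_expR_mul.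
Qed.

(** [phi] is a minorant of [Z] since max(0, w) <= exp w. If [phi u] were zero, -<u, F> would be
    nonpositive almost everywhere, contrary to the sign condition. *)
Lemma partition_function_min :
  (forall u, u != 0 -> (0 < mu [set x | dotp u (F x) < 0]%R)%E) ->
  exists u, forall v, Z u <= Z v.
Proof.
move=> neg; apply: (@continuous_coercive_min _ _ Z phi).
- exact: partition_function_continuous.
- apply: locally_lipschitz_continuous => r.
  exists (\int[mu]_x (p%:R * N x)) => u v _ _.
  apply: (@lipschitz_of_integrand (fun u x => Num.max 0 (- dotp u (F x)))).
  + exact: iphi.
  + exact: iphi.
  + by apply: eq_integrable (integrableZl measurableT p%:R iN).
  move=> x; rewrite mulrA (mulrC `|_|); apply: le_trans (normr_dotp_le_bound _ _).
  rewrite dotpBl; move: (dotp u (F x)) (dotp v (F x)) => a b.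
  have := ler_norm (a - b); have := ler_norm (b - a); rewrite distrC.
  by case: (leP 0 (- a)); case: (leP 0 (- b)) => *; rewrite ler_norml; lra.
- move=> u; apply: le_Rintegral => //; [exact: exp_dotp_integrable|move=> x _].
  by rewrite ge_max expR_ge0 (le_trans _ (expR_ge1Dx _))// lerDr.
- move=> a u a0; rewrite /phi -RintegralZl//; apply: eq_Rintegral => x _.
  by rewrite dotpZl -mulrN maxr_pMr// mulr0.
move=> u u0; rewrite lt_neqAle Rintegral_ge0 ?andbT => [|x _]; last first.
  by rewrite le_max lexx.
apply/eqP => phi0; have := neg u u0; apply/negP; rewrite -leNgt.
have mneg : measurable [set x | dotp u (F x) < 0].
  rewrite (_ : mkset _ = setT `&` (fun x => dotp u (F x)) @^-1` `]-oo, 0[%classic).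
    exact: mF.
  by rewrite setTI; apply/seteqP; split => x /=; rewrite in_itv.
have : ae_eq mu setT (EFin \o (fun x => Num.max 0 (- dotp u (F x)))) (cst 0%E).
  apply/(ae_eq_integral_abs _ measurableT); first exact: measurable_int (iphi u).
  under eq_integral do rewrite gee0_abs ?lee_fin ?le_max ?lexx//.
  by rewrite -[LHS]fineK ?integrable_fin_num//; congr EFin; exact: esym phi0.
move=> [B [mB B0 sB]]; rewrite -B0; apply: le_measure; rewrite ?inE// => x /= Fx0.
apply: sB => /= /(_ I) [] /eqP; rewrite eq_le ge_max lexx/= => /andP[+ _].
by rewrite oppr_le0 leNgt Fx0.
Qed.

End partition_function.

(** * Gibbs measures on Euclidean space *)

Lemma powR_le_superlinear (R : realType) (a b c eta : R) :
  0 <= a -> a < b -> 0 <= c -> 0 < eta ->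
  exists K, forall t, 0 <= t -> c * t `^ a <= K + eta * t `^ b.
Proof.
move=> a0 ab c0 eta0; pose t0 := (c / eta) `^ (b - a)^-1.
exists (c * t0 `^ a + c) => t.
have ta_le1 : 0 `^ a <= 1 :> R by rewrite /powR eqxx; case: (a == 0).
rewrite le_eqVlt => /predU1P[<-|tpos].
  apply: (@le_trans _ _ c); first by rewrite ler_piMr.
  by rewrite -addrA addrCA lerDl addr_ge0 ?mulr_ge0 ?powR_ge0 ?(ltW eta0).
have [tt0|t0t] := leP t t0.
  apply: (@le_trans _ _ (c * t0 `^ a)).
    by rewrite ler_wpM2l// ge0_ler_powR// ?nnegrE ?powR_ge0// ltW.
  by rewrite -addrA lerDl addr_ge0// mulr_ge0 ?powR_ge0 ?(ltW eta0).
have c_le : c <= eta * t `^ (b - a).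
  rewrite mulrC -ler_pdivrMr//.
  rewrite -[c / eta]powRr1 ?divr_ge0 ?(ltW eta0)//.
  rewrite -(@mulVf _ (b - a)) ?subr_eq0 ?gt_eqF// powRrM.
  by rewrite ge0_ler_powR ?nnegrE ?powR_ge0 ?subr_ge0 ?ltW.
apply: (@le_trans _ _ (eta * t `^ b)); last first.
  by rewrite lerDr addr_ge0 ?mulr_ge0 ?powR_ge0.
rewrite -[in leRHS](subrK a b) powRD ?(gt_eqF tpos) ?implybT// mulrA.
by rewrite ler_wpM2r ?powR_ge0.
Qed.

Lemma continuous_borel_rV_measurable (R : realType) (n : nat) (f : 'rV[R]_n -> R) :
  continuous f -> measurable_fun [set: borel_rV R n] f.
Proof.
move=> /continuousP cf; apply: (measurability _ (RGenOpens.measurableE R)).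
move=> _ [_ [a [b ->] <-]]; rewrite setTI; apply: sub_sigma_algebra.
exact/cf/interval_open.
Qed.

Lemma continuous_enorm (R : realType) (n : nat) : continuous (@enorm R n).
Proof.
move=> u; apply: (@continuous_comp _ _ _ (fun v : 'rV[R]_n => dotp v v)).
  by apply: (@continuous_dotp _ _ _ id id) => v; exact: cvg_id.
exact: sqrt_continuous.
Qed.

Section moment_weight.
Context (R : realType) (d p : nat).
Variables (alpha C : R).
Hypothesis C_ge0 : 0 <= C.

(* The factor is C + 1 rather than C so that the weight dominates both the
   components of F and the moment of order alpha. *)
Definition moment_weight (x : borel_rV R d) : R :=
  (C + 1) * (1 + enorm (x : 'rV[R]_d) `^ alpha).

Lemma measurable_enorm_powR b :
  measurable_fun [set: borel_rV R d] (fun x => enorm (x : 'rV[R]_d) `^ b).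
Proof.
apply: (measurableT_comp (measurable_powR b)).
by apply: continuous_borel_rV_measurable; exact: continuous_enorm.
Qed.

Lemma measurable_moment_weight : measurable_fun [set: borel_rV R d] moment_weight.
Proof.
apply: measurable_funM => //; apply: measurable_funD => //.
exact: measurable_enorm_powR.
Qed.

Lemma moment_weight_ge0 x : 0 <= moment_weight x.
Proof. by rewrite mulr_ge0 ?addr_ge0 ?powR_ge0. Qed.

(** Turns the moment condition into integrability of the single weight that also bounds the
    components of F. *)
Lemma moment_probP (nu : probability (borel_rV R d) R) :
  moment_prob alpha nu <-> nu.-integrable setT (EFin \o moment_weight).
Proof.
have C1 : 0 < C + 1 by rewrite ltr_wpDl.
split=> [nualpha|nuN].
  have i1 : nu.-integrable setT (EFin \o cst (1 : R)).
    exact: finite_measure_integrable_cst.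
  have ia : nu.-integrable setT
      (EFin \o (fun x : borel_rV R d => enorm (x : 'rV[R]_d) `^ alpha)).
    apply/integrableP; split.
      by apply/measurable_EFinP; exact: measurable_enorm_powR.
    by under eq_integral do rewrite /= ger0_norm ?powR_ge0//.
  by apply: eq_integrable (integrableZl measurableT (C + 1)
    (integrableD measurableT i1 ia)).
apply: le_lt_trans (integrable_lty measurableT nuN).
apply: ge0_le_integral => //.
- by move=> x _; rewrite lee_fin powR_ge0.
- by apply/measurable_EFinP; exact: measurable_enorm_powR.
- by apply/measurable_EFinP; exact: measurable_moment_weight.
move=> x _; rewrite lee_fin /moment_weight mulrDl mul1r ler_wpDl//.
  by rewrite mulr_ge0// addr_ge0// powR_ge0.
by rewrite lerDr.
Qed.

Lemma moment_weight_exp_integrable (mu : probability (borel_rV R d) R)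
    (alpha' eta c : R) :
  0 <= alpha -> alpha < alpha' -> 0 < eta ->
  (\int[mu]_x (expR (eta * enorm (x : 'rV[R]_d) `^ alpha'))%:E < +oo)%E ->
  mu.-integrable setT (fun x => (expR (c * moment_weight x))%:E).
Proof.
move=> alpha0 alphaa' eta0 muoo.
have [K Kle] := powR_le_superlinear alpha0 alphaa' (normr_ge0 (c * (C + 1))) eta0.
have imu : mu.-integrable setT
    (EFin \o (fun x : borel_rV R d => expR (eta * enorm (x : 'rV[R]_d) `^ alpha'))).
  apply/integrableP; split.
    apply/measurable_EFinP; apply: measurableT_comp => //.
    apply: measurable_funM => //; exact: measurable_enorm_powR.
  by under eq_integral do rewrite /= ger0_norm ?expR_ge0//.
(* In the exponent, c (C + 1) comes from the summand 1 of the weight and K from the comparison of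
   powers, made with |c (C + 1)| since c may be negative. *)
apply: le_integrable (integrableZl measurableT (expR (c * (C + 1) + K)) imu) => //.
  apply/measurable_EFinP; apply: measurableT_comp => //.
  apply: measurable_funM => //; exact: measurable_moment_weight.
move=> x _ /=; rewrite lee_fin !ger0_norm ?mulr_ge0 ?expR_ge0// -expRD ler_expR.
rewrite /moment_weight mulrA mulrDr mulr1 -addrA lerD2l.
apply: le_trans (Kle _ (enorm_ge0 _)).
by rewrite ler_wpM2r ?powR_ge0// ler_norm.
Qed.

End moment_weight.

Section gibbs_measures.
Context (R : realType) (d p : nat).
Variables (mu : probability (borel_rV R d) R) (F : 'rV[R]_d -> 'rV[R]_p).
Variables (alpha C : R).
Hypothesis C_ge0 : 0 <= C.
Hypothesis F_continuous : continuous F.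

Let N := @moment_weight R d alpha C.

Hypothesis FN : forall (x : borel_rV R d) i, `|F x 0 i| <= N x.
Hypothesis expN : forall c, mu.-integrable setT (fun x => (expR (c * N x))%:E).

Let mN : measurable_fun [set: borel_rV R d] N.
Proof. exact: measurable_moment_weight. Qed.

Let N_ge0 x : 0 <= N x. Proof. exact: moment_weight_ge0. Qed.

Let mdotF u : measurable_fun [set: borel_rV R d] (fun x => dotp u (F x)).
Proof.
apply: continuous_borel_rV_measurable.
by apply: (@continuous_dotp _ _ _ (cst u) F) => // x; exact: cst_continuous.
Qed.

Let mF i : measurable_fun [set: borel_rV R d] (fun x => F x 0 i).
Proof. by under eq_fun do rewrite -dotp_deltal; exact: mdotF. Qed.

Let Z theta := \int[mu]_x expR (- dotp theta (F x)).

Let Z_gt0 theta : 0 < Z theta.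
Proof. exact: partition_function_gt0 expN mdotF FN theta. Qed.

Let iexp theta : mu.-integrable setT (EFin \o (fun x => expR (- dotp theta (F x)))).
Proof. exact: exp_dotp_integrable expN mdotF FN theta. Qed.

Let g theta (x : borel_rV R d) :=
  expR (- dotp theta (F x) - log_partition mu F theta).

Let gE theta x : g theta x = (Z theta)^-1 * expR (- dotp theta (F x)).
Proof.
rewrite /g expRD (expRN (log_partition _ _ _)) /log_partition lnK 1?mulrC//.
by rewrite posrE; exact: Z_gt0.
Qed.

Let mg theta : measurable_fun [set: borel_rV R d] (g theta).
Proof.
apply: measurableT_comp => //; apply: measurable_funB => //.
exact: measurable_funN.
Qed.

Let g_gt0 theta x : 0 < g theta x. Proof. exact: expR_gt0. Qed.

Let g1 theta : (\int[mu]_x (g theta x)%:E = 1)%E.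
Proof.
under eq_integral do rewrite gE EFinM.
rewrite integralZl//; last exact: iexp.
rewrite -(fineK (integrable_fin_num measurableT (iexp theta))) -EFinM.
by rewrite -/(Z theta) mulVf// gt_eqF// Z_gt0.
Qed.

Section moment.
Variable nu : probability (borel_rV R d) R.
Hypothesis nuN : nu.-integrable setT (EFin \o N).

Let iF i : nu.-integrable setT (EFin \o (fun x => F x 0 i)).
Proof.
apply: le_integrable nuN => //; first exact/measurable_EFinP.
by move=> x _ /=; rewrite lee_fin [leRHS]ger0_norm.
Qed.

Let idotF theta : nu.-integrable setT (EFin \o (fun x => dotp theta (F x))).
Proof.
apply: le_integrable (integrableZl measurableT (p%:R * `|theta|) nuN) => //.
  exact/measurable_EFinP.
move=> x _ /=; rewrite lee_fin.
have pN : 0 <= p%:R * `|theta| * N x.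
  exact: mulr_ge0 (mulr_ge0 (ler0n _ _) (normr_ge0 _)) (N_ge0 x).
by rewrite (ger0_norm pN); exact: normr_dotp_le.
Qed.

Lemma integral_dotp_mean theta :
  (\int[nu]_x (dotp theta (F x))%:E = (dotp theta (mean nu F))%:E)%E.
Proof.
under eq_integral do rewrite /dotp -sumEFin.
rewrite integral_sum//; last first.
  by move=> i; apply: eq_integrable (integrableZl measurableT (theta 0 i) (iF i)).
rewrite /dotp -sumEFin; apply: eq_bigr => i _.
under eq_integral do rewrite EFinM.
rewrite integralZl//; last exact: iF.
by rewrite mxE EFinM fineK//; exact: (integrable_fin_num measurableT (iF i)).
Qed.

Let ilng theta : nu.-integrable setT (fun x => (ln (g theta x))%:E).
Proof.
have ic : nu.-integrable setT (EFin \o cst (log_partition mu F theta)).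
  exact: finite_measure_integrable_cst.
apply: eq_integrable (integrableB measurableT (integrableN (idotF theta)) ic) => //.
by move=> x _; rewrite expRK.
Qed.

Let int_lng theta : (\int[nu]_x (ln (g theta x))%:E =
  (- dotp theta (mean nu F) - log_partition mu F theta)%:E)%E.
Proof.
have ic : nu.-integrable setT (EFin \o cst (log_partition mu F theta)).
  exact: finite_measure_integrable_cst.
under eq_integral do rewrite expRK -dotpNl EFinB.
rewrite integralB//; last exact: idotF.
rewrite integral_dotp_mean integral_cst// [X in (_ * X)%E]probability_setT.
by rewrite mule1 -EFinB dotpNl.
Qed.

(** The variational principle with the Gibbs density, whose logarithm is affine in F; without
    absolute continuity the entropy is infinite. *)
Lemma KL_ge theta :
  ((- dotp theta (mean nu F) - log_partition mu F theta)%:E <= KL nu mu)%E.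
Proof.
rewrite /KL; case: asboolP => [numu|_]; last by rewrite leey.
rewrite -int_lng; exact: integral_ln_le_relative_entropy.
Qed.

Lemma KL_eq_gibbs theta :
  KL nu mu = (- dotp theta (mean nu F) - log_partition mu F theta)%:E <->
  is_gibbs mu F theta nu.
Proof.
rewrite -int_lng /KL /is_gibbs; case: asboolP => [numu|nnumu]; last first.
  by split=> [|[]//]; rewrite int_lng.
rewrite relative_entropy_eq_integral_ln//.
by split=> [|[]].
Qed.

End moment.

(** Since -<theta, F> <= p |theta| N, tilting only shifts the exponent. Optimality can then be
    tested under the Gibbs measure itself. *)
Lemma gibbs_exp_integrable nu theta c : is_gibbs mu F theta nu ->
  nu.-integrable setT (fun x => (expR (c * N x))%:E).
Proof.
move=> [numu nug]; apply: (density_integrable numu nug).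
  by apply: measurableT_comp => //; exact: measurable_funM.
have Z_inv_ge0 : 0 <= (Z theta)^-1 by rewrite invr_ge0 ltW.
apply: le_integrable (integrableZl measurableT (Z theta)^-1
  (expN (c + p%:R * `|theta|))) => //.
  apply/measurable_EFinP; apply: measurable_funM; last exact: mg.
  by apply: measurableT_comp => //; exact: measurable_funM.
move=> x _ /=; rewrite -/(g theta x) lee_fin gE mulrCA.
rewrite !ger0_norm ?mulr_ge0 ?expR_ge0// ler_wpM2l// mulrDl expRD.
by rewrite ler_wpM2l ?expR_ge0//; apply: (@exp_dotp_le _ (borel_rV R d) R p N F FN).
Qed.

Lemma gibbs_moment_weight_integrable nu theta : is_gibbs mu F theta nu ->
  nu.-integrable setT (EFin \o N).
Proof.
move=> /(gibbs_exp_integrable 1); apply: le_integrable => //.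
  exact/measurable_EFinP.
move=> x _ /=; rewrite lee_fin !ger0_norm ?expR_ge0// mul1r.
by rewrite (le_trans _ (expR_ge1Dx _))// lerDr.
Qed.

(** Under [nu] the integral of exp (t F_i) is Z(theta - t e_i) / Z(theta), at least 1 for every t by
    minimality, so [integral_eq0_exp_ge1] applies to each component. *)
Lemma gibbs_mean0 nu theta : is_gibbs mu F theta nu ->
  (forall theta', Z theta <= Z theta') -> mean nu F = 0.
Proof.
move=> gibbs Zmin; apply/rowP => i; rewrite !mxE.
apply: (@integral_eq0_exp_ge1 _ _ _ _ N) => //.
  by move=> c; exact: gibbs_exp_integrable gibbs.
move=> t; have [numu nug] := gibbs.
have expE x : expR (t * F x 0 i) * g theta x =
    (Z theta)^-1 * expR (- dotp (theta - t *: delta_mx 0 i) (F x)).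
  rewrite gE mulrCA -expRD dotpBl dotpZl dotp_deltal; congr (_ * expR _); ring.
have ie : mu.-integrable setT (fun x => (expR (t * F x 0 i) * g theta x)%:E).
  by under eq_fun do rewrite expE EFinM; apply: integrableZl => //; exact: iexp.
rewrite /Rintegral (density_integral numu nug)//; last first.
  by apply: measurableT_comp => //; exact: measurable_funM.
under eq_integral do rewrite expE EFinM.
rewrite integralZl//; last exact: iexp.
rewrite fineM ?integrable_fin_num//; last exact: iexp.
by rewrite /= mulrC ler_pdivlMr// mul1r; exact: Zmin.
Qed.

Lemma gibbs_solution : charges_negative_side mu F ->
  exists (theta : 'rV[R]_p) (nu : probability (borel_rV R d) R),
     solves_Q alpha mu F theta /\
     is_gibbs mu F theta nu /\
     is_the_solution_P alpha mu F nu.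
Proof.
move=> neg.
have [theta Zmin] : exists theta, forall theta', Z theta <= Z theta'.
  apply: (partition_function_min mN N_ge0 expN mdotF FN) => u u0.
  have e0 := enorm_gt0 u0.
  (* The sign of <F, u> is unchanged by positive scaling, so the condition on the Euclidean unit
     sphere reaches every nonzero u. *)
  have := neg ((enorm u)^-1 *: u); rewrite enormZ ger0_norm ?invr_ge0 ?enorm_ge0//.
  rewrite mulVf ?gt_eqF// => /(_ erefl); congr (_ < mu _)%E.
  apply/seteqP; split => x /=; by rewrite (dotpC (F x)) dotpZl pmulr_rlt0 ?invr_gt0.
have [nu [numu nug]] := exists_probability_density (mg theta)
  (fun x => ltW (g_gt0 theta x)) (g1 theta).
have gibbs : is_gibbs mu F theta nu by [].
have nuN := gibbs_moment_weight_integrable gibbs.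
have mean0 := gibbs_mean0 gibbs Zmin.
have nualpha : moment_prob alpha nu by apply/(moment_probP alpha C_ge0).
have KLnu : KL nu mu = (- log_partition mu F theta)%:E.
  by have /(KL_eq_gibbs nuN) -> := gibbs; rewrite mean0 dotp0r oppr0 sub0r.
have KL_min nu' : feasible_prob alpha F nu' -> (KL nu mu <= KL nu' mu)%E.
  move=> [/(moment_probP alpha C_ge0) nu'N mean'0].
  by have := KL_ge nu'N theta; rewrite mean'0 dotp0r oppr0 sub0r -KLnu.
exists theta, nu; split; [|split => //].
  split=> [|theta' _]; first exact: integrable_lty (iexp theta).
  (* [KL nu mu] separates the dual values: [nu] has mean zero and competes in the infimum at theta',
     while [KL_ge] bounds the infimum at theta from below. *)
  apply: (@le_trans _ _ (KL nu mu)).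
    by apply: ereal_inf_lbound; exists nu => //; rewrite mean0 dotp0r adde0.
  apply/ereal_infP => _ [nu' /(moment_probP alpha C_ge0) nu'N <-].
  by rewrite KLnu -leeBlDr// -EFinB addrC; exact: KL_ge.
split=> [//|nu' [[nu'alpha mean'0] nu'min] A mA].
have nu'N : nu'.-integrable setT (EFin \o N) by apply/(moment_probP alpha C_ge0).
(* Another solution attains the same entropy, hence equality in the variational principle, hence the
   same density. *)
have [nu'mu nu'g] : is_gibbs mu F theta nu'.
  apply/(KL_eq_gibbs nu'N); rewrite mean'0 dotp0r oppr0 sub0r -KLnu.
  apply/eqP; rewrite eq_le KL_min// andbT; exact: nu'min.
rewrite (density_measure nu'mu nu'g (mg theta))//.
by rewrite (density_measure numu nug (mg theta)).
Qed.

End gibbs_measures.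

Theorem proposition5 (R : realType) (d p : nat)
  (mu : probability (borel_rV R d) R)
  (F : 'rV[R]_d -> 'rV[R]_p)
  (F_vanishes : exists x0 : 'rV[R]_d, F x0 = 0)
  (alpha alpha' : R) (alpha_ge0 : 0 <= alpha) (alpha_lt : alpha < alpha')
  (F_continuous : continuous F)
  (F_growth : exists C : R, 0 <= C /\
    (ereal_sup [set (enorm (F x) * (1 + enorm x `^ alpha)^-1)%:E
                | x in [set: 'rV[R]_d]] <= C%:E)%E)
  (mu_moment : exists eta : R, 0 < eta /\
    (\int[mu]_x (expR (eta * enorm (x : 'rV[R]_d) `^ alpha'))%:E < +oo)%E) :
  (charges_negative_side mu F ->
   exists (theta : 'rV[R]_p) (nu : probability (borel_rV R d) R),
     solves_Q alpha mu F theta /\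
     is_gibbs mu F theta nu /\
     is_the_solution_P alpha mu F nu) /\
  ((forall A : set 'rV[R]_d, open A -> A !=set0 ->
      (0 < mu (A : set (borel_rV R d)))%E) ->
   (exists x : 'rV[R]_d, [/\ F x = 0, differentiable F x &
      0 < \det (jacobian_mx F x *m (jacobian_mx F x)^T)]) ->
   charges_negative_side mu F).
Proof.
have [C [C_ge0 Cle]] := F_growth; have [eta [eta_gt0 mu_eta]] := mu_moment.
split=> [neg|mu_gt0 [x [Fx0 Fx J_gt0]]]; last first.
  apply: charges_negative_side_regular_zero Fx0 Fx _ => //.
  by rewrite unitmxE unitfE gt_eqF.
apply: (@gibbs_solution _ _ _ _ _ _ C) => // [x i|c].
  (* Each component is at most the Euclidean norm, which the growth bound controls by C (1 +
     |x|^alpha), below the weight. *)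
  apply: le_trans (coord_le_enorm _ _) _.
  have w_gt0 : 0 < 1 + enorm x `^ alpha by rewrite ltr_wpDr ?powR_ge0.
  have : ((enorm (F x) * (1 + enorm x `^ alpha)^-1)%:E <= C%:E)%E.
    by apply: le_trans Cle; apply: ereal_sup_ubound; exists x.
  rewrite lee_fin ler_pdivrMr// => /le_trans; apply.
  by rewrite /moment_weight ler_wpM2r ?(ltW w_gt0)// lerDl.
exact: (moment_weight_exp_integrable C c alpha_ge0 alpha_lt eta_gt0 mu_eta).
Qed.
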